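(* Let $f(x) = \frac12\langle Ax,x\rangle - \langle b,x\rangle$, $x \in \mathbb{E}$, where $A : \mathbb{E}\to\mathbb{E}^*$ is a self-adjoint positive definite linear operator with $\mu B \preceq A \preceq LB$ for some $\mu, L>0$, and $b \in \mathbb{E}^*$. Let $(x_k)_{k \ge 0}$, $(G_k)_{k\ge 0}$ be generated by the quasi-Newton scheme described in the context, where for each $k \ge 0$ we choose $u_k = \bar{u}_A(G_k)$ (with arbitrary $x_0 \in \mathbb{E}$ and $\tau_k \in [0,1]$). Then, for all $k \geq 0$, we have $$A \preceq G_k \preceq \left(1 + \left(1 - \frac{\mu}{nL}\right)^k\frac{nL}{\mu}\right)A,$$ and $$\lambda_f(x_{k+1}) \leq \left(1 - \frac{\mu}{nL}\right)^k\frac{nL}{\mu}\cdot\lambda_f(x_k).$$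
   Context: $\mathbb{E}$ is an $n$-dimensional real vector space, $\mathbb{E}^*$ its dual, and $\langle s, x\rangle$ is the value of $s \in \mathbb{E}^*$ at $x \in \mathbb{E}$. For self-adjoint $A, A_1 : \mathbb{E} \to \mathbb{E}^*$, $A \preceq A_1$ means $\langle (A_1 - A)x, x\rangle \ge 0$ for all $x \in \mathbb{E}$. For $u \in \mathbb{E}$, $u^*$ denotes the map $s \mapsto \langle s, u\rangle$ on $\mathbb{E}^*$; thus $uu^* : \mathbb{E}^*\to\mathbb{E}$ is $s \mapsto \langle s,u\rangle u$, and e.g. $Auu^*G$ is the operator $\mathbb{E}\to\mathbb{E}^*$, $x \mapsto \langle Gx, u\rangle Au$. A basis $e_1,\dots,e_n$ of $\mathbb{E}$ is fixed, and $B = \left(\sum_{i=1}^n e_ie_i^*\right)^{-1} : \mathbb{E}\to\mathbb{E}^*$. For self-adjoint positive definite $A$, self-adjoint $G$ with $A \preceq G$, $u \in \mathbb{E}$ and $\tau \in \mathbb{R}$: if $Gu \ne Au$, define $$\mathrm{Broyd}_\tau(G,A,u) = \tau\left[G - \frac{Auu^*G + Guu^*A}{\langle Au,u\rangle} + \left(\frac{\langle Gu,u\rangle}{\langle Au,u\rangle}+1\right)\frac{Auu^*A}{\langle Au,u\rangle}\right] + (1-\tau)\left[G - \frac{(G-A)uu^*(G-A)}{\langle (G-A)u,u\rangle}\right],$$ and if $Gu = Au$, define $\mathrm{Broyd}_\tau(G,A,u) = G$. Greedy direction: $\bar{u}_A(G) = \operatorname*{argmax}_{u \in \{e_1,\dots,e_n\}}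 \frac{\langle Gu,u\rangle}{\langle Au,u\rangle}$, i.e. any basis vector attaining the maximum. Quasi-Newton scheme: choose $x_0 \in \mathbb{E}$ and set $G_0 = LB$. For $k \ge 0$: (1) $x_{k+1} = x_k - G_k^{-1}\nabla f(x_k)$; (2) choose $u_k \in \mathbb{E}$ and $\tau_k \in [0,1]$; (3) $G_{k+1} = \mathrm{Broyd}_{\tau_k}(G_k, A, u_k)$. (The scheme is well-defined, since $A \preceq G_k$ for all $k$.) $\lambda_f(x) = \langle \nabla f(x), A^{-1}\nabla f(x)\rangle^{1/2}$. *)

(* Defs.v *)
From HB Require Import structures.
From mathcomp Require Import all_boot all_order all_algebra.
From mathcomp Require Import all_classical all_reals all_analysis.
Set Implicit Arguments.
Unset Strict Implicit.
Unset Printing Implicit Defensive.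
Import Order.TTheory GRing.Theory Num.Theory.
Import numFieldNormedType.Exports.
Import VectorInternalTheory.
Local Open Scope ring_scope.

(* The dual of E is 'Hom(E, R^o), and <s, x> is the application s x. *)

Section Operators.
Variables (R : realType) (E : vectType R).
Implicit Types (A G : 'Hom(E, 'Hom(E, R^o))) (u x y : E).

Definition self_adjoint A := forall x y, A x y = A y x.

Definition pos_def A := forall x, x != 0 -> 0 < A x x.

Definition loewner_le A A1 := forall x, 0 <= (A1 - A) x x.

(* The rank-one operator u u^* : E^* -> E. *)
Definition outer_fun u (s : 'Hom(E, R^o)) : E := s u *: u.

Fact outer_fun_is_linear u : linear (outer_fun u).
Proof.
by move=> a s t; rewrite /outer_fun lfunE/= scalerDl lfunE/= scalerA.
Qed.

HB.instance Definition _ u := GRing.isLinear.Build R 'Hom(E, R^o) E _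
  (outer_fun u) (outer_fun_is_linear u).

Definition outer u : 'Hom('Hom(E, R^o), E) := linfun (outer_fun u).

(* f^-1%VF is a total pseudo-inverse; it is the two-sided inverse of f when
   f is bijective, as is the case here when e is a basis. *)
Definition basis_form n (e : n.-tuple E) : 'Hom(E, 'Hom(E, R^o)) :=
  (\sum_(i < n) outer (tnth e i))^-1%VF.

Definition broyd (tau : R) G A u : 'Hom(E, 'Hom(E, R^o)) :=
  if G u == A u then G else
    tau *: (G
      - (A u u)^-1 *: ((A \o outer u \o G)%VF + (G \o outer u \o A)%VF)
      + ((G u u / A u u + 1) / A u u) *: (A \o outer u \o A)%VF)
    + (1 - tau) *: (G
      - ((G - A) u u)^-1 *: ((G - A) \o outer u \o (G - A))%VF).

Definition greedy_direction n (e : n.-tuple E) A G u :=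
  u \in e /\ forall v, v \in e -> G v v / A v v <= G u u / A u u.

(* The Frechet derivative of f at x, computed in the linear coordinates
   v2r : E -> 'rV_(dim E), on which the library provides a norm; it does not
   depend on the coordinates, as all norms on E are equivalent. *)
Definition gradient_fun (f : E -> R) x (h : E) : R^o :=
  'd (f \o r2v : 'rV[R]_(dim E) -> R^o) (v2r x) (v2r h).

Fact gradient_fun_is_linear f x : linear (gradient_fun f x).
Proof. by move=> a h k; rewrite /gradient_fun !linearP. Qed.

HB.instance Definition _ f x := GRing.isLinear.Build R E R^o _
  (gradient_fun f x) (gradient_fun_is_linear f x).

Definition gradient f x : 'Hom(E, R^o) := linfun (gradient_fun f x).

Definition quadratic A (b : 'Hom(E, R^o)) x : R := 2^-1 * A x x - b x.

Definition lambda A (f : E -> R) x : R :=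
  Num.sqrt (gradient f x (A^-1%VF (gradient f x))).

Record quasi_newton_scheme n (e : n.-tuple E) A (L : R) (f : E -> R)
    (x_ : nat -> E) (G_ : nat -> 'Hom(E, 'Hom(E, R^o)))
    (u_ : nat -> E) (tau_ : nat -> R) : Prop := {
  qn_init : G_ 0%N = L *: basis_form e ;
  qn_step : forall k, x_ k.+1 = x_ k - (G_ k)^-1%VF (gradient f (x_ k)) ;
  qn_tau : forall k, 0 <= tau_ k <= 1 ;
  qn_update : forall k, G_ k.+1 = broyd (tau_ k) (G_ k) A (u_ k) }.

End Operators.

(* Main.v *)
From HB Require Import structures.
Require Import Defs.
From mathcomp Require Import all_boot all_order all_algebra.
From mathcomp Require Import all_classical all_reals all_analysis.
From mathcomp Require Import ring lra.
Import Order.TTheory GRing.Theory Num.Theory.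
Import numFieldNormedType.Exports VectorInternalTheory.
Local Open Scope ring_scope.

(** The proof follows the potential sigma(G) = <A^-1, G - A>, the trace of the
    excess G - A measured in the geometry of A.  As long as A <= G the excess
    is positive semidefinite, so G - A <= sigma(G) A: the trace of an operator
    dominates its largest eigenvalue ([psd_le_trace]).  Both conclusions then
    only need sigma(G_k) <= (1 - mu/(nL))^k nL/mu.

    Writing X = G - A, both ends of the Broyden family preserve A <= G
    ([broyd_ge]) and decrease sigma by at least <Xu,u>/<Au,u>: the tau-part
    exactly by that amount, the other part by <Xu, A^-1 Xu>/<Xu,u>, which is
    at least as much by Cauchy-Schwarz ([trace_broyd_le]).  The greedy choice
    makes this ratio at least its average over the basis; as <Ae_i,e_i> <= L
    and mu A^-1 <= B^-1 = sum e_i e_i^*, that average is at least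
    mu sigma(G)/(nL) ([greedy_ratio_ge]).  Hence sigma contracts by
    1 - mu/(nL).  At the start, sigma(LB) <= L <A^-1, B> <= nL/mu.

    For the rate of lambda, put z = x - A^-1 b.  Then the gradient is Az,
    lambda(x)^2 = <Az,z>, and a step replaces z by w = z - G^-1 A z.  If
    A <= G <= (1 + c) A, then Aw = (G - A)y with y = G^-1 A z, and
    Cauchy-Schwarz for G - A and for A gives <Aw,w> <= c^2 <Az,z>
    ([newton_step_contraction]).

    Traces against A^-1 are computed without inverse operators or
    coordinates: a finite list v of vectors with X^-1 = sum_(y in v) y y^*
    (for instance an X-orthonormal basis) turns <X^-1, Y> into the sum of the
    <Y y, y>.  Such a list exists for every positive definite X
    ([exists_resolution]), and e itself is one for B by definition. *)

Set Implicit Arguments.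
Unset Strict Implicit.
Unset Printing Implicit Defensive.

(** * Positive forms and resolutions of their inverse *)

(** The value of a functional lives in the regular module R^o; reading it as
    an element of R gives access to the order and field structure of R. *)
Definition pairing (R : realType) (E : vectType R) (s : 'Hom(E, R^o)) (x : E)
  : R := s x.

Local Notation "⟨ s , x ⟩" := (pairing s x) (format "⟨ s ,  x ⟩").

Section Forms.
Variables (R : realType) (E : vectType R).
Local Notation form := 'Hom(E, 'Hom(E, R^o)).
Implicit Types (A G X Y B : form) (s t : 'Hom(E, R^o)) (c : R) (u x y z : E).

Let pairingDl s t x : ⟨s + t, x⟩ = ⟨s, x⟩ + ⟨t, x⟩.
Proof. exact: add_lfunE. Qed.
Let pairingNl s x : ⟨- s, x⟩ = - ⟨s, x⟩. Proof. exact: opp_lfunE. Qed.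
Let pairingZl c s x : ⟨c *: s, x⟩ = c * ⟨s, x⟩. Proof. exact: scale_lfunE. Qed.
Let pairingDr s x y : ⟨s, x + y⟩ = ⟨s, x⟩ + ⟨s, y⟩. Proof. exact: linearD. Qed.
Let pairingNr s x : ⟨s, - x⟩ = - ⟨s, x⟩. Proof. exact: linearN. Qed.
Let pairingZr c s x : ⟨s, c *: x⟩ = c * ⟨s, x⟩. Proof. exact: linearZ. Qed.
Let formDl X Y x : (X + Y) x = X x + Y x. Proof. exact: add_lfunE. Qed.
Let formNl X x : (- X) x = - X x. Proof. exact: opp_lfunE. Qed.
Let formZl c X x : (c *: X) x = c *: X x. Proof. exact: scale_lfunE. Qed.
Let formDr X x y : X (x + y) = X x + X y. Proof. exact: linearD. Qed.
Let formNr X x : X (- x) = - X x. Proof. exact: linearN. Qed.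
Let formZr c X x : X (c *: x) = c *: X x. Proof. exact: linearZ. Qed.

Definition pairingE := ((formDl, formNl, formZl), (formDr, formNr, formZr),
  (pairingDl, pairingNl, pairingZl), (pairingDr, pairingNr, pairingZr)).

Lemma pairing_sumr s (I : Type) (v : seq I) (F : I -> E) :
  ⟨s, \sum_(y <- v) F y⟩ = \sum_(y <- v) ⟨s, F y⟩.
Proof. exact: linear_sum. Qed.

Lemma eq_pairing s t : (forall x, ⟨s, x⟩ = ⟨t, x⟩) -> s = t.
Proof. by move=> h; apply/lfunP. Qed.

Lemma pairingC X x y : self_adjoint X -> ⟨X x, y⟩ = ⟨X y, x⟩.
Proof. exact. Qed.

Definition psd X := forall x, 0 <= ⟨X x, x⟩.

Lemma loewner_leP X Y : loewner_le X Y <-> forall x, ⟨X x, x⟩ <= ⟨Y x, x⟩.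
Proof.
have E0 x : (0 <= ⟨(Y - X) x, x⟩) = (⟨X x, x⟩ <= ⟨Y x, x⟩).
  by rewrite !pairingE subr_ge0.
by split=> h x; have := h x; rewrite -/(pairing _ _) -?E0.
Qed.

Lemma self_adjointB X Y :
  self_adjoint X -> self_adjoint Y -> self_adjoint (X - Y).
Proof.
move=> Xsa Ysa x y; rewrite -!/(pairing _ _) !pairingE.
by rewrite (pairingC x y Xsa) (pairingC x y Ysa).
Qed.

Lemma pos_def_gt0 X x : pos_def X -> x != 0 -> 0 < ⟨X x, x⟩.
Proof. by move=> Xpd; exact: Xpd. Qed.

Lemma pos_def_psd X : pos_def X -> psd X.
Proof.
move=> Xpd x; have [->|/(pos_def_gt0 Xpd)/ltW//] := eqVneq x 0.
by rewrite -(scale0r (0 : E)) !pairingE mul0r.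
Qed.

Lemma pos_def_eq0 X x : pos_def X -> ⟨X x, x⟩ <= 0 -> x = 0.
Proof.
move=> Xpd; have [//|/(pos_def_gt0 Xpd) Xx] := eqVneq x 0.
by rewrite leNgt Xx.
Qed.

Lemma form_expand X (a c : R) x y : self_adjoint X ->
  ⟨X (a *: x + c *: y), a *: x + c *: y⟩ =
    a ^+ 2 * ⟨X x, x⟩ + 2 * (a * c) * ⟨X x, y⟩ + c ^+ 2 * ⟨X y, y⟩.
Proof. by move=> Xsa; rewrite !pairingE (pairingC y x Xsa); ring. Qed.

(** The form is only semidefinite, so the usual minimizer - p / r of the
    quadratic t |-> <X(x + ty), x + ty> may not exist; when r = 0 the quadratic
    is affine and nonnegative, which forces p = 0. *)
Lemma cauchy_schwarz X x y : self_adjoint X -> psd X ->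
  ⟨X x, y⟩ ^+ 2 <= ⟨X x, x⟩ * ⟨X y, y⟩.
Proof.
move=> Xsa X0.
have key (a c : R) : 0 <=
    a ^+ 2 * ⟨X x, x⟩ + 2 * (a * c) * ⟨X x, y⟩ + c ^+ 2 * ⟨X y, y⟩.
  by rewrite -form_expand.
have q0 := X0 x; have r0 := X0 y.
move: key q0 r0.
move: ⟨X x, y⟩ ⟨X x, x⟩ ⟨X y, y⟩ => p q r key q0 r0.
have [r_eq0|rn0] := eqVneq r 0.
  have [->|pn0] := eqVneq p 0; first by rewrite expr0n/= mulr_ge0.
  (* A point where the affine function q + 2tp equals -1. *)
  have := key 1 (- (q + 1) / (2 * p)).
  rewrite r_eq0 (_ : _ + _ = -1); first by rewrite oppr_ge0 ler10.
  by field.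
have r_gt0 : 0 < r by rewrite lt_def rn0.
have := key r (- p).
rewrite (_ : _ + _ = r * (q * r - p ^+ 2)); last by ring.
by rewrite pmulr_rge0// subr_ge0.
Qed.

(** This says sum_(y in v) y y^* = X^-1, in a form that makes sense for any
    list and does not mention the inverse. *)
Definition resolves X (v : seq E) := forall x, x = \sum_(y <- v) ⟨X x, y⟩ *: y.

(** When v resolves A, this is <A^-1, X>, the trace of A^-1 X. *)
Definition trace (v : seq E) X : R := \sum_(y <- v) ⟨X y, y⟩.

(** Gram-Schmidt: split off one normalized vector w of a subspace U, and recurse
    in the X-orthogonal complement of w in U.  As the remaining
    vectors stay in that complement, x and its projection have the same
    coefficients on them. *)
Lemma exists_resolution X : self_adjoint X -> pos_def X ->
  exists v, resolves X v.
Proof.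
move=> Xsa Xpd.
suff H m (U : {vspace E}) : (\dim U < m)%N ->
    exists v : seq E, {subset v <= U} /\
      {in U, forall x, x = \sum_(y <- v) ⟨X x, y⟩ *: y}.
  have [v [_ vP]] := H _ fullv (ltnSn _).
  by exists v => x; apply: vP; rewrite memvf.
elim: m U => [//|m IH] U dU.
have [U0|Un0] := eqVneq U 0%VS.
  exists [::]; split=> // x; rewrite U0 memv0 => /eqP ->.
  by rewrite big_nil.
pose w := vpick U.
have wn0 : w != 0 by rewrite vpick0.
have Xw := pos_def_gt0 Xpd wn0.
have wU : w \in U := memv_pick U.
pose U' := (U :&: lker (X w))%VS.
have mem_U' x : (x \in U') = (x \in U) && (⟨X w, x⟩ == 0).
  by rewrite memv_cap memv_ker.
have dU' : (\dim U' < m)%N.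
  rewrite -ltnS; apply: leq_trans dU; rewrite ltnS.
  rewrite ltn_neqAle dimvS ?capvSl// andbT.
  apply/negP => /eqP dE.
  have /eqP UE : U' == U by rewrite eqEdim capvSl dE leqnn.
  by move: wU; rewrite -UE mem_U' (gt_eqF Xw) andbF.
have [v [vU vP]] := IH _ dU'.
pose c : R := Num.sqrt ⟨X w, w⟩.
have cn0 : c != 0 by rewrite sqrtr_eq0 -ltNge.
have c2 : c ^+ 2 = ⟨X w, w⟩ by rewrite sqr_sqrtr// ltW.
exists (c^-1 *: w :: v); split=> [y|x xU].
  rewrite inE => /predU1P[->|/vU]; first by rewrite memvZ.
  by rewrite mem_U' => /andP[].
pose t : R := ⟨X x, w⟩ / ⟨X w, w⟩.
have x'U : x - t *: w \in U'.
  rewrite mem_U' memvB ?memvZ//= !pairingE (pairingC w x Xsa).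
  by rewrite /t divfK ?subrr// gt_eqF.
have /eqP := vP _ x'U.
rewrite subr_eq => /eqP xE.
rewrite {1}xE big_cons addrC; congr (_ + _).
  rewrite !pairingE scalerA; congr (_ *: _).
  by rewrite /t -c2 expr2 invfM; ring.
rewrite !big_seq; apply: eq_bigr => y /vU.
by rewrite mem_U' !pairingE => /andP[_ /eqP ->]; rewrite mulr0 subr0.
Qed.

Section Resolution.
Variables (X : form) (v : seq E).
Hypotheses (Xsa : self_adjoint X) (Xv : resolves X v).

(** X^-1 s, read off from X^-1 = sum_(y in v) y y^*. *)
Definition riesz s : E := \sum_(y <- v) ⟨s, y⟩ *: y.

Lemma pairing_riesz s t : ⟨s, riesz t⟩ = \sum_(y <- v) ⟨s, y⟩ * ⟨t, y⟩.
Proof.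
by rewrite pairing_sumr; apply: eq_bigr => y _; rewrite !pairingE mulrC.
Qed.

Lemma rieszP s : X (riesz s) = s.
Proof.
apply/eq_pairing => z; rewrite pairingC// pairing_riesz [in RHS](Xv z).
rewrite pairing_sumr.
by apply: eq_bigr => y _; rewrite !pairingE.
Qed.

Lemma parseval x : ⟨X x, x⟩ = \sum_(y <- v) ⟨X x, y⟩ ^+ 2.
Proof.
by rewrite {2}(Xv x) pairing_sumr; apply: eq_bigr => y _; rewrite !pairingE.
Qed.

(** Cauchy-Schwarz between x and X^-1 s, since the sum on the right is
    <s, X^-1 s>. *)
Lemma dual_cauchy_schwarz s x : psd X ->
  ⟨s, x⟩ ^+ 2 <= ⟨X x, x⟩ * \sum_(y <- v) ⟨s, y⟩ ^+ 2.
Proof.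
move=> X0; under eq_bigr do rewrite expr2; rewrite -pairing_riesz.
by rewrite -{1 2}(rieszP s) mulrC cauchy_schwarz.
Qed.

Lemma surj_lfun_inv s : X (X^-1%VF s) = s.
Proof.
by apply: limg_lfunVK; rewrite -(rieszP s) memv_img ?memvf.
Qed.

End Resolution.

Lemma pos_def_invK X s : self_adjoint X -> pos_def X -> X (X^-1%VF s) = s.
Proof.
by move=> Xsa Xpd; have [v Xv] := exists_resolution Xsa Xpd;
   apply: (surj_lfun_inv Xsa Xv).
Qed.

Lemma pos_def_inj X x y : pos_def X -> X x = X y -> x = y.
Proof.
move=> Xpd Xxy; apply/eqP; rewrite -subr_eq0; apply/eqP.
apply: (pos_def_eq0 Xpd); rewrite (_ : X (x - y) = 0 *: X x).
  by rewrite !pairingE mul0r.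
by rewrite !pairingE Xxy subrr scale0r.
Qed.

Lemma traceD v X Y : trace v (X + Y) = trace v X + trace v Y.
Proof. by rewrite -big_split; apply: eq_bigr => y _; rewrite !pairingE. Qed.

Lemma traceB v X Y : trace v (X - Y) = trace v X - trace v Y.
Proof. by rewrite -sumrB; apply: eq_bigr => y _; rewrite !pairingE. Qed.

Lemma traceZ v (a : R) X : trace v (a *: X) = a * trace v X.
Proof. by rewrite [RHS]mulr_sumr; apply: eq_bigr => y _; rewrite !pairingE. Qed.

Lemma trace_ge0 v X : psd X -> 0 <= trace v X.
Proof. by move=> X0; apply: sumr_ge0 => y _; apply: X0. Qed.

(** Divide by <Xx,x>: the dual Cauchy-Schwarz inequality applied to s = Xx
    leaves the sum of the <Xx,y>^2, and each is at most <Xx,x><Xy,y>. *)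
Lemma psd_le_trace A v X x : self_adjoint A -> psd A -> resolves A v ->
  self_adjoint X -> psd X -> ⟨X x, x⟩ <= trace v X * ⟨A x, x⟩.
Proof.
move=> Asa A0 Av Xsa X0.
have [Xx0|] := eqVneq ⟨X x, x⟩ 0.
  by rewrite Xx0 mulr_ge0// ?trace_ge0.
move=> Xn0; have Xx : 0 < ⟨X x, x⟩ by rewrite lt_def Xn0 X0.
rewrite -(ler_pM2l Xx) -expr2.
apply: le_trans (dual_cauchy_schwarz Asa Av (X x) x A0) _.
rewrite [leRHS]mulrA [leRHS]mulrC ler_wpM2l//.
rewrite mulr_sumr; apply: ler_sum => y _.
exact: cauchy_schwarz.
Qed.

(** The hypothesis mu B <= A means mu A^-1 <= B^-1.  Resolving X itself writes X
    as a sum of rank-one forms s s^*, for which the claim reads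
    mu <s, A^-1 s> <= <s, B^-1 s>; that follows from the dual Cauchy-Schwarz
    inequality of B at w = A^-1 s. *)
Lemma pos_def_trace_compare A B (mu : R) (a e : seq E) X :
  self_adjoint A -> self_adjoint B -> psd A -> psd B ->
  resolves A a -> resolves B e -> 0 < mu -> loewner_le (mu *: B) A ->
  self_adjoint X -> pos_def X -> mu * trace a X <= trace e X.
Proof.
move=> Asa Bsa A0 B0 Aa Be mu0 /loewner_leP BA Xsa Xpd.
have rank1 s : mu * \sum_(y <- a) ⟨s, y⟩ ^+ 2 <= \sum_(y <- e) ⟨s, y⟩ ^+ 2.
  set S := (X in _ <= X).
  have S0 : 0 <= S by apply: sumr_ge0 => y _; rewrite sqr_ge0.
  pose w := riesz a s.
  have sw : ⟨s, w⟩ = \sum_(y <- a) ⟨s, y⟩ ^+ 2 by rewrite pairing_riesz.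
  rewrite -sw.
  have Aw : A w = s by rewrite (rieszP Asa Aa).
  have sw0 : 0 <= ⟨s, w⟩ by rewrite -Aw.
  have [->|swn0] := eqVneq ⟨s, w⟩ 0; first by rewrite mulr0.
  have {swn0 sw0} swp : 0 < ⟨s, w⟩ by rewrite lt_def swn0 sw0.
  rewrite -(ler_pM2r swp) -mulrA -expr2.
  have := BA w; rewrite !pairingE Aw => BAw.
  have := dual_cauchy_schwarz Bsa Be s w B0; rewrite -/S => /(ler_wpM2l (ltW mu0)).
  move=> /le_trans; apply.
  by rewrite mulrA mulrC ler_wpM2l.
have [v Xv] := exists_resolution Xsa Xpd.
have trE r : trace r X = \sum_(z <- v) \sum_(y <- r) ⟨X z, y⟩ ^+ 2.
  rewrite exchange_big /=; apply: eq_bigr => y _.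
  by rewrite (parseval Xv y); apply: eq_bigr => z _; rewrite (pairingC y z Xsa).
by rewrite !trE mulr_sumr; apply: ler_sum => z _; exact: rank1.
Qed.

(** A semidefinite X has no resolution, but X + d A has one for every d > 0, and
    both traces are continuous in d. *)
Lemma trace_compare A B (mu : R) (a e : seq E) X :
  self_adjoint A -> self_adjoint B -> pos_def A -> psd B ->
  resolves A a -> resolves B e -> 0 < mu -> loewner_le (mu *: B) A ->
  self_adjoint X -> psd X -> mu * trace a X <= trace e X.
Proof.
move=> Asa Bsa Apd B0 Aa Be mu0 BA Xsa X0.
have A0 := pos_def_psd Apd.
apply/ler_addgt0Pr => eps eps0.
pose d := eps / (1 + trace e A).
have te0 : 0 <= trace e A by apply: trace_ge0.
have t1 : 0 < 1 + trace e A by rewrite ltr_pwDl.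
have d0 : 0 < d by rewrite divr_gt0.
have Ysa : self_adjoint (X + d *: A).
  move=> x y; rewrite -!/(pairing _ _) !pairingE.
  by rewrite (pairingC x y Xsa) (pairingC x y Asa).
have Ypd : pos_def (X + d *: A).
  move=> x xn0; rewrite -/(pairing _ _) !pairingE.
  by apply: ltr_wpDl => //; apply: mulr_gt0 => //; apply: pos_def_gt0.
have := pos_def_trace_compare Asa Bsa A0 B0 Aa Be mu0 BA Ysa Ypd.
rewrite !traceD !traceZ mulrDr.
have ta0 : 0 <= mu * (d * trace a A).
  apply: mulr_ge0; first exact: ltW.
  by apply: mulr_ge0; [exact: ltW | exact: trace_ge0].
have : d * trace e A <= eps.
  by rewrite /d mulrAC ler_pdivrMr// ler_pM2l//; lra.
lra.
Qed.

End Forms.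

(** * The form B of the basis e *)

Section Basis.
Variables (R : realType) (E : vectType R) (n : nat) (e : n.-tuple E).
Hypothesis basis_e : basis_of {:E} e.

(** The operator sum e_i e_i^* is onto because the coordinate functionals supply
    a preimage of every x; so its pseudo-inverse B is a true right inverse, and
    the identity sum <Bx,e_i> e_i = x is the resolution. *)
Lemma basis_form_resolves : resolves (basis_form e) e.
Proof.
move=> x; pose S : 'Hom('Hom(E, R^o), E) := \sum_(i < n) outer (tnth e i).
have SE s : S s = \sum_(y <- e) ⟨s, y⟩ *: y.
  rewrite sum_lfunE big_tuple; apply: eq_bigr => i _.
  by rewrite lfunE.
have x_limg : x \in limg S.
  pose s : 'Hom(E, R^o) := \sum_(i < n) coord e i x *: linfun (coord e i).
  suff -> : x = S s by rewrite memv_img ?memvf.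
  rewrite SE {1}(coord_basis basis_e (memvf x)) big_tuple.
  apply: eq_bigr => i _; rewrite (tnth_nth 0); congr (_ *: _).
  rewrite /pairing sum_lfunE (bigD1 i)//= big1 => [|j ji];
    rewrite scale_lfunE lfunE /= coord_free ?(basis_free basis_e)//.
    by rewrite eqxx addr0 /GRing.scale/= mulr1.
  by rewrite eq_sym (negPf ji) scaler0.
by rewrite -{1}(limg_lfunVK x_limg) SE.
Qed.

Lemma basis_form_sa : self_adjoint (basis_form e).
Proof.
move=> x y; rewrite -!/(pairing _ _).
rewrite {1}(basis_form_resolves y) {2}(basis_form_resolves x) !pairing_sumr.
by apply: eq_bigr => z _; rewrite !pairingE mulrC.
Qed.

Lemma basis_form_psd : psd (basis_form e).
Proof.
move=> x; rewrite (parseval basis_form_resolves).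
by apply: sumr_ge0 => y _; apply: sqr_ge0.
Qed.

(** Compare the i-th coordinates of the two sides of the resolution of e_i. *)
Lemma basis_form_mem y : y \in e -> ⟨basis_form e y, y⟩ = 1.
Proof.
move=> /tnthP[i ->]; have := congr1 (coord e i) (basis_form_resolves (tnth e i)).
rewrite big_tuple [in RHS]linear_sum /= (tnth_nth 0).
rewrite coord_free ?(basis_free basis_e)// eqxx (bigD1 i)//= big1 => [|j ji].
  rewrite addr0 (tnth_nth 0) linearZ /= coord_free ?(basis_free basis_e)//.
  by rewrite eqxx mulr1.
rewrite linearZ /= (tnth_nth 0 e j) coord_free ?(basis_free basis_e)//.
by rewrite (negPf ji) mulr0.
Qed.

Lemma trace_basis_form : trace e (basis_form e) = n%:R.
Proof.
rewrite /trace big_seq (eq_bigr (fun=> 1)) => [|y]; last exact: basis_form_mem.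
by rewrite -big_seq big_const_seq count_predT size_tuple iter_addr addr0.
Qed.

End Basis.

(** * The Broyden update *)

Section Broyden.
Variables (R : realType) (E : vectType R).
Variables (A G : 'Hom(E, 'Hom(E, R^o))) (u : E) (tau : R).
Hypotheses (Asa : self_adjoint A) (Apd : pos_def A) (Gsa : self_adjoint G).
Hypotheses (AG : loewner_le A G) (tau01 : 0 <= tau <= 1) (un0 : u != 0).

Let X := G - A.
Let Xsa : self_adjoint X. Proof. exact: self_adjointB. Qed.
Let X0 : psd X. Proof. exact: AG. Qed.
Let alpha := ⟨A u, u⟩.
Let beta := ⟨X u, u⟩.
Let gamma := ⟨G u, u⟩.
Let alpha_gt0 : 0 < alpha. Proof. exact: pos_def_gt0. Qed.
Let gammaE : gamma = alpha + beta.
Proof. by rewrite /beta /X !pairingE -/alpha -/gamma; ring. Qed.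

(** If <Xu,u> = 0, then Xu = 0 by Cauchy-Schwarz, so the denominator in the
    update vanishes only in the degenerate case Gu = Au. *)
Let beta_gt0 : G u != A u -> 0 < beta.
Proof.
move=> GAu; rewrite lt_def X0 andbT; apply: contraNneq GAu => b0.
apply/eqP/eq_pairing => y; apply/eqP; rewrite -subr_eq0.
have := cauchy_schwarz u y Xsa X0.
rewrite -/beta b0 mul0r => h.
have : ⟨X u, y⟩ ^+ 2 == 0 by rewrite eq_le h sqr_ge0.
by rewrite sqrf_eq0 /X !pairingE.
Qed.

Lemma pairing_broyd x y : G u != A u ->
  ⟨broyd tau G A u x, y⟩ = ⟨G x, y⟩
    + tau * ((gamma / alpha + 1) / alpha * (⟨A u, x⟩ * ⟨A u, y⟩)
             - alpha^-1 * (⟨G u, x⟩ * ⟨A u, y⟩ + ⟨A u, x⟩ * ⟨G u, y⟩))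
    - (1 - tau) * (beta^-1 * (⟨X u, x⟩ * ⟨X u, y⟩)).
Proof.
move=> /negPf GAu; rewrite /broyd GAu.
have rankone (P Q : 'Hom(E, 'Hom(E, R^o))) z : self_adjoint Q ->
    (P \o outer u \o Q)%VF z = ⟨Q u, z⟩ *: P u.
  move=> Qsa; rewrite !comp_lfunE lfunE /= linearZ /=.
  by rewrite -/(pairing _ _) pairingC.
rewrite -/(pairing (G u) u) -/(pairing (A u) u) -/(pairing ((G - A) u) u).
rewrite -/X -/alpha -/beta -/gamma.
rewrite (pairingE, rankone)//.
do !rewrite ?pairingE ?rankone//.
rewrite -/X.
ring.
Qed.

Lemma broyd_sa : self_adjoint (broyd tau G A u).
Proof.
have [GAu|GAu] := eqVneq (G u) (A u); first by rewrite /broyd GAu eqxx.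
move=> x y; rewrite -!/(pairing _ _) !pairing_broyd// (pairingC x y Gsa).
ring.
Qed.

(** The excess of the tau-part is the form X at x - <Au,x>/<Au,u> u, the
    A-orthogonal projection of x along u; that of the other part is
    <Xx,x> - <Xu,x>^2/<Xu,u>, nonnegative by Cauchy-Schwarz. *)
Lemma broyd_ge : loewner_le A (broyd tau G A u).
Proof.
have [GAu|GAu] := eqVneq (G u) (A u); first by rewrite /broyd GAu eqxx.
have b0 := beta_gt0 GAu.
apply/loewner_leP => x; rewrite pairing_broyd//.
have := X0 (1 *: x + - (⟨A u, x⟩ / alpha) *: u).
rewrite form_expand// -/beta.
rewrite (pairingC x u Xsa).
have := cauchy_schwarz u x Xsa X0.
rewrite -/beta mulrC -ler_pdivrMr// [_ / beta]mulrC.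
set w := beta^-1 * _ => sr1.
have -> : ⟨G u, x⟩ = ⟨A u, x⟩ + ⟨X u, x⟩ by rewrite /X !pairingE; ring.
have -> : ⟨G x, x⟩ = ⟨A x, x⟩ + ⟨X x, x⟩ by rewrite /X !pairingE; ring.
rewrite -expr2 -/w gammaE => dfp.
case/andP: tau01 => t0 t1.
rewrite -subr_ge0.
set d := (X in 0 <= X) in dfp.
rewrite (_ : _ - _ = tau * d + (1 - tau) * (⟨X x, x⟩ - w)).
  by rewrite addr_ge0// mulr_ge0// subr_ge0.
rewrite /d; field; exact: lt0r_neq0.
Qed.

(** The trace of a rank-one term s t^* with t = Au is <s,u>, so the tau-part
    changes the trace by 1 - gamma/alpha = - beta/alpha.  The other part removes
    t2/beta, where t2 = <Xu, A^-1 Xu> is at least beta^2/alpha by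
    Cauchy-Schwarz. *)
Lemma trace_broyd_le (a : seq E) : resolves A a ->
  trace a (broyd tau G A u) <= trace a G - beta / alpha.
Proof.
move=> Aa.
have [GAu|GAu] := eqVneq (G u) (A u).
  rewrite /broyd GAu eqxx (_ : beta = 0) ?mul0r ?subr0//.
  by rewrite /beta /X !pairingE GAu subrr.
have b0 := beta_gt0 GAu.
pose t2 := \sum_(y <- a) ⟨X u, y⟩ ^+ 2.
have t2_ge : beta / alpha <= beta^-1 * t2.
  rewrite ler_pdivrMr// -mulrA ler_pdivlMl// -expr2 [t2 * _]mulrC.
  exact: (dual_cauchy_schwarz Asa Aa (X u) u (pos_def_psd Apd)).
have pair_u s : \sum_(y <- a) ⟨s, y⟩ * ⟨A u, y⟩ = ⟨s, u⟩.
  rewrite [in RHS](Aa u) pairing_sumr; apply: eq_bigr => y _.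
  by rewrite !pairingE mulrC.
have -> : trace a (broyd tau G A u) = trace a G - tau * (beta / alpha)
    - (1 - tau) * (beta^-1 * t2).
  pose c1 := tau * ((gamma / alpha + 1) / alpha).
  pose c2 := - (tau * (alpha^-1 * 2)).
  pose c3 := - ((1 - tau) * beta^-1).
  transitivity (\sum_(y <- a) (⟨G y, y⟩ + (c1 * (⟨A u, y⟩ * ⟨A u, y⟩)
      + (c2 * (⟨G u, y⟩ * ⟨A u, y⟩) + c3 * ⟨X u, y⟩ ^+ 2)))).
    apply: eq_bigr => y _; rewrite pairing_broyd// /c1 /c2 /c3; ring.
  rewrite !big_split -!mulr_sumr !pair_u -/t2 -/alpha -/gamma -/(trace a G).
  rewrite /c1 /c2 /c3 gammaE /=; field.
  by rewrite !lt0r_neq0.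
case/andP: tau01 => _ t1.
have := ler_wpM2l (_ : 0 <= 1 - tau) t2_ge; rewrite subr_ge0 => /(_ t1).
lra.
Qed.

End Broyden.

(** * The gradient of a quadratic function *)

Section Gradient.
Variables (R : realType) (E : vectType R).

Lemma is_diff_big_sum (V W : normedModType R) (I : Type) (r : seq I)
    (f df : I -> V -> W) (x : V) : (forall i, is_diff x (f i) (df i)) ->
  is_diff x (\sum_(i <- r) f i) (\sum_(i <- r) df i).
Proof.
move=> fx; elim/big_rec2: _ => [|i g dg _ gx]; first exact: is_diff_cst.
exact: is_diffD.
Qed.

(** A functional is its own derivative once it is known to be continuous, which
    holds in finite dimension as it is a combination of the coordinates. *)
Lemma is_diff_pairing (s : 'Hom(E, R^o)) (v : 'rV[R]_(dim E)) :
  is_diff v (fun w : 'rV[R]_(dim E) => ⟨s, r2v w⟩ : R)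
            (fun w : 'rV[R]_(dim E) => ⟨s, r2v w⟩ : R).
Proof.
pose phi (w : 'rV[R]_(dim E)) : R := ⟨s, r2v w⟩.
have phi_diff x : differentiable phi x.
  have -> : phi = \sum_(i < dim E)
      (fun w : 'rV[R]_(dim E) => w 0 i *: phi (delta_mx 0 i)).
    apply/funext => w; rewrite fct_sumE {1}/phi {1}(row_sum_delta w).
    rewrite linear_sum pairing_sumr; apply: eq_bigr => i _.
    by rewrite linearZ !pairingE.
  apply: differentiable_sum => i; apply: differentiableZl.
  exact: differentiable_coord.
have phi_lin : linear phi by move=> c x y; rewrite /phi linearP !pairingE.
pose phiM := GRing.isLinear.Build _ _ _ _ _ phi_lin.
pose phiL : {linear _ -> _} := HB.pack phi phiM.
apply: DiffDef; first exact: phi_diff.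
apply: (@diff_lin R _ _ phiL) => x.
exact/differentiable_continuous/phi_diff.
Qed.

(** A resolution of A writes <Ax,x> as a sum of squares of functionals, so the
    product rule for real-valued functions is enough. *)
Lemma gradient_quadratic (A : 'Hom(E, 'Hom(E, R^o))) b x :
  self_adjoint A -> pos_def A -> gradient (quadratic A b) x = A x - b.
Proof.
move=> Asa Apd; have [a Aa] := exists_resolution Asa Apd.
pose phi y (w : 'rV[R]_(dim E)) : R := ⟨A y, r2v w⟩.
have fE : quadratic A b \o r2v =
    2^-1 *: \sum_(y <- a) (phi y * phi y) - (fun w => ⟨b, r2v w⟩).
  apply/funext => w; rewrite /quadratic /= -!/(pairing _ _) (parseval Aa).
  rewrite !fctE fct_sumE; congr (_ * _ - _).
  by apply: eq_bigr => y _; rewrite expr2 -[RHS]/(phi y w * phi y w)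
    /phi (pairingC y _ Asa).
have df : is_diff (v2r x) (quadratic A b \o r2v : 'rV[R]_(dim E) -> R)
    (2^-1 *: \sum_(y <- a) (phi y (v2r x) *: phi y + phi y (v2r x) *: phi y)
     - (fun w => ⟨b, r2v w⟩)).
  rewrite fE; apply: is_diffB; last exact: is_diff_pairing.
  apply: is_diffZ; apply: is_diff_big_sum => y; apply: is_diffM;
    exact: is_diff_pairing.
apply: eq_pairing => h; rewrite /pairing lfunE /= /gradient_fun.
rewrite (@diff_val _ _ _ _ _ _ _ df) !fctE fct_sumE.
rewrite -/(pairing _ _) !pairingE v2rK; congr (_ - _).
rewrite [in RHS](Aa h) pairing_sumr scaler_sumr; apply: eq_bigr => y _.
rewrite -[LHS]/(2^-1 * (phi y (v2r x) * phi y (v2r h)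
                        + phi y (v2r x) * phi y (v2r h))).
rewrite /phi !v2rK !pairingE (pairingC y x Asa) (pairingC y h Asa).
by field.
Qed.

End Gradient.

(** * One step of the scheme *)

Section Steps.
Variables (R : realType) (E : vectType R).
Implicit Types (A G : 'Hom(E, 'Hom(E, R^o))) (b : 'Hom(E, R^o)).

(** The greedy choice maximizes <Gv,v>/<Av,v> = 1 + <Xv,v>/<Av,v>, so its ratio
    r satisfies <Xv,v> <= L r for every v in e; summing, mu <A^-1, X> <=
    <B^-1, X> <= n L r. *)
Lemma greedy_ratio_ge n (e : n.-tuple E) A G a u (mu L : R) :
  basis_of {:E} e -> self_adjoint A -> pos_def A -> 0 < mu -> 0 < L ->
  loewner_le (mu *: basis_form e) A -> loewner_le A (L *: basis_form e) ->
  self_adjoint G -> loewner_le A G -> resolves A a ->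
  greedy_direction e A G u ->
  mu / (n%:R * L) * trace a (G - A) <= ⟨(G - A) u, u⟩ / ⟨A u, u⟩.
Proof.
move=> be Asa Apd mu0 L0 muA /loewner_leP AL Gsa AG Aa [ue umax].
have e_neq0 v : v \in e -> v != 0.
  by move=> ve; exact: (free_not0 (basis_free be) ve).
have n0 : 0 < n%:R :> R.
  by rewrite ltr0n; move: ue; rewrite -index_mem size_tuple; apply: leq_ltn_trans.
have A_gt0 v : v \in e -> 0 < ⟨A v, v⟩ by move=> /e_neq0; exact: pos_def_gt0.
have A_leL v : v \in e -> ⟨A v, v⟩ <= L.
  by move=> ve; have := AL v; rewrite !pairingE basis_form_mem// mulr1.
set r := _ / ⟨A u, u⟩.
have ratio_le v : v \in e -> ⟨(G - A) v, v⟩ / ⟨A v, v⟩ <= r.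
  have rE w : w \in e ->
      ⟨(G - A) w, w⟩ / ⟨A w, w⟩ = ⟨G w, w⟩ / ⟨A w, w⟩ - 1.
    by move=> /A_gt0 Aw; rewrite !pairingE mulrBl divff// gt_eqF.
  by move=> ve; rewrite /r !rE// lerB// umax.
have v_le v : v \in e -> ⟨(G - A) v, v⟩ <= L * r.
  move=> ve; have := ratio_le _ ve; rewrite ler_pdivrMr ?A_gt0// => /le_trans.
  apply; rewrite mulrC ler_wpM2r ?A_leL//.
  by apply: divr_ge0; [exact: AG | exact/ltW/A_gt0].
have tr_le : trace e (G - A) <= n%:R * (L * r).
  rewrite /trace big_seq; apply: (le_trans (ler_sum _ v_le)).
  by rewrite -big_seq big_const_seq count_predT size_tuple iter_addr addr0
             mulr_natl.
have := trace_compare Asa (basis_form_sa be) Apd (basis_form_psd be) Aa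
  (basis_form_resolves be) mu0 muA (self_adjointB Gsa Asa) AG.
move=> /le_trans/(_ tr_le) h.
by rewrite mulrAC ler_pdivrMr ?mulr_gt0// mulrC [r * _]mulrC -mulrA mulrC.
Qed.

(** Centering at the minimizer A^-1 b turns the gradient into a value of A. *)
Lemma lambda_quadratic A b x : self_adjoint A -> pos_def A ->
  let z := x - A^-1%VF b in
  gradient (quadratic A b) x = A z /\
  lambda A (quadratic A b) x = Num.sqrt ⟨A z, z⟩.
Proof.
move=> Asa Apd z.
have gE : gradient (quadratic A b) x = A z.
  by rewrite gradient_quadratic// /z linearB /= pos_def_invK.
split=> //; rewrite /lambda gE; congr (Num.sqrt (pairing _ _)).
by apply: (pos_def_inj Apd); rewrite pos_def_invK.
Qed.

(** With y = G^-1 A z and X = G - A, one has Aw = Xy.  Hence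
    <Aw,w>^2 = <Xy,w>^2 <= <Xy,y><Xw,w> <= c <Xy,y><Aw,w>, so that
    <Aw,w> <= c <Xy,y> <= c^2 <Ay,y>; and <Ay,y> <= <Gy,y> = <Az,y> yields
    <Ay,y> <= <Az,z>. *)
Lemma newton_step_contraction A G (c : R) z :
  self_adjoint A -> pos_def A -> self_adjoint G -> 0 <= c ->
  loewner_le A G -> loewner_le G ((1 + c) *: A) ->
  ⟨A (z - G^-1%VF (A z)), z - G^-1%VF (A z)⟩ <= c ^+ 2 * ⟨A z, z⟩.
Proof.
move=> Asa Apd Gsa c0 AG /loewner_leP GcA; set w := z - _.
have A0 := pos_def_psd Apd.
have /loewner_leP AGle := AG.
have Gpd : pos_def G.
  by move=> x /(pos_def_gt0 Apd) /lt_le_trans; apply; apply: AGle.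
pose y := G^-1%VF (A z).
have Gy : G y = A z by rewrite /y pos_def_invK.
have Xsa := self_adjointB Gsa Asa.
have Aw : A w = (G - A) y by rewrite /w !pairingE -/y Gy.
have X_le x : ⟨(G - A) x, x⟩ <= c * ⟨A x, x⟩.
  by have := GcA x; rewrite !pairingE; lra.
have cs_le p q : 0 <= p -> 0 <= q -> p ^+ 2 <= q * p -> p <= q :> R.
  move=> p0 q0; have [->//|pn0] := eqVneq p 0.
  by rewrite expr2 ler_pM2r// lt_def pn0.
have Aw_le : ⟨A w, w⟩ <= c * ⟨(G - A) y, y⟩.
  apply: cs_le => //; first by rewrite mulr_ge0//; apply: AG.
  rewrite {1}Aw; apply: le_trans (cauchy_schwarz y w Xsa AG) _.
  rewrite -mulrA mulrCA; apply: ler_wpM2l => //; exact: AG.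
have Ay_le : ⟨A y, y⟩ <= ⟨A z, z⟩.
  apply: cs_le => //; apply: le_trans (cauchy_schwarz z y Asa A0).
  rewrite ler_sqr ?nnegrE//; last by rewrite -Gy; apply: pos_def_psd.
  by rewrite -Gy.
apply: le_trans Aw_le _; rewrite expr2 -mulrA ler_wpM2l//.
by apply: le_trans (X_le _) _; rewrite ler_wpM2l.
Qed.

End Steps.

(** * Linear convergence of the greedy scheme *)

Theorem theorem3p4 (R : realType) (E : vectType R) (n : nat)
    (e : n.-tuple E) (dimE : \dim {:E} = n) (basis_e : basis_of {:E} e)
    (A : 'Hom(E, 'Hom(E, R^o))) (b : 'Hom(E, R^o)) (mu L : R)
    (A_sa : self_adjoint A) (A_pd : pos_def A)
    (mu_gt0 : 0 < mu) (L_gt0 : 0 < L)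
    (mu_le : loewner_le (mu *: basis_form e) A)
    (le_L : loewner_le A (L *: basis_form e))
    (x_ : nat -> E) (G_ : nat -> 'Hom(E, 'Hom(E, R^o)))
    (u_ : nat -> E) (tau_ : nat -> R)
    (scheme : quasi_newton_scheme e A L (quadratic A b) x_ G_ u_ tau_)
    (greedy : forall k, greedy_direction e A (G_ k) (u_ k)) :
  forall k : nat,
    [/\ loewner_le A (G_ k),
        loewner_le (G_ k)
          ((1 + (1 - mu / (n%:R * L)) ^+ k * (n%:R * L / mu)) *: A) &
        lambda A (quadratic A b) (x_ k.+1)
          <= (1 - mu / (n%:R * L)) ^+ k * (n%:R * L / mu)
             * lambda A (quadratic A b) (x_ k)].
Proof.
have [a Aa] := exists_resolution A_sa A_pd.
have A0 := pos_def_psd A_pd.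
have n_gt0 : (0 < n)%N.
  case: (greedy 0%N) => ue _.
  by move: ue; rewrite -index_mem size_tuple; apply: leq_ltn_trans.
have n0 : 0 < n%:R :> R by rewrite ltr0n.
have u_neq0 k : u_ k != 0.
  by case: (greedy k) => ue _; exact: (free_not0 (basis_free basis_e) ue).
pose rho : R := 1 - mu / (n%:R * L).
have mu_leL : mu <= L.
  case: (greedy 0%N) => ue _.
  have /loewner_leP/(_ (u_ 0%N)) := mu_le; have /loewner_leP/(_ (u_ 0%N)) := le_L.
  by rewrite !pairingE basis_form_mem// !mulr1 => h1 h2; apply: le_trans h2 h1.
have rho_ge0 : 0 <= rho.
  rewrite subr_ge0 ler_pdivrMr ?mulr_gt0// mul1r (le_trans mu_leL)//.
  by rewrite ler_peMl ?ler1n ?(ltW L_gt0).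
case: scheme => qn0 qnx qntau qnG.
(* Starting from sigma(LB) <= nL/mu, each update contracts sigma by rho. *)
have inv k : [/\ self_adjoint (G_ k), loewner_le A (G_ k) &
    trace a (G_ k - A) <= rho ^+ k * (n%:R * L / mu)].
  elim: k => [|k [Gsa AG tr]].
    have Bsa := basis_form_sa basis_e; have B0 := basis_form_psd basis_e.
    rewrite qn0; split=> //.
      by move=> x y; rewrite -!/(pairing _ _) !pairingE (pairingC x y Bsa).
    rewrite expr0 mul1r traceB traceZ.
    have := trace_compare A_sa Bsa A_pd B0 Aa (basis_form_resolves basis_e)
      mu_gt0 mu_le Bsa B0.
    rewrite (trace_basis_form basis_e) => h.
    apply: (@le_trans _ _ (L * trace a (basis_form e))).
      by rewrite gerBl trace_ge0.
    by rewrite ler_pdivlMr// -mulrA [n%:R * L]mulrC ler_pM2l// mulrC.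
  have ratio := greedy_ratio_ge basis_e A_sa A_pd mu_gt0 L_gt0 mu_le le_L Gsa AG
    Aa (greedy k).
  have step := trace_broyd_le A_sa A_pd Gsa AG (qntau k) (u_neq0 k) Aa.
  rewrite qnG; split; [exact: broyd_sa | exact: broyd_ge |].
  apply: le_trans (_ : rho * trace a (G_ k - A) <= _); last first.
    by rewrite exprS -mulrA ler_wpM2l.
  rewrite traceB mulrBl mul1r; move: ratio step; rewrite traceB; lra.
move=> k; have [Gsa AG tr] := inv k; rewrite -/rho.
set c := rho ^+ k * _ in tr *.
have c0 : 0 <= c by apply: le_trans tr; apply: trace_ge0.
have Gle : loewner_le (G_ k) ((1 + c) *: A).
  apply/loewner_leP => x; rewrite !pairingE.
  have := psd_le_trace x A_sa A0 Aa (self_adjointB Gsa A_sa) AG.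
  have := ler_wpM2r (A0 x) tr.
  rewrite !pairingE; lra.
split=> //.
have [_ ->] := lambda_quadratic b (x_ k.+1) A_sa A_pd.
have [gE ->] := lambda_quadratic b (x_ k) A_sa A_pd.
rewrite -[X in X * _]ger0_norm// -sqrtr_sqr -sqrtrM ?sqr_ge0//.
apply: ler_wsqrtr.
rewrite qnx gE addrAC.
exact: newton_step_contraction.
Qed.
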